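(* Let $R$ be a $d\times d$ expansive integer matrix and let $B\subset\mathbb{Z}^d$ be a (finite) simple digit set for $R$. Then the affine iterated function system $\{\tau_b\}_{b\in B}$, $\tau_b(x)=R^{-1}(x+b)$, satisfies the open set condition, the strong open set condition and the no-overlap condition.
   Context: A matrix is expansive if all its eigenvalues have modulus $>1$. A finite set $B\subset\mathbb{Z}^d$ is a simple digit set for $R$ if distinct elements of $B$ are not congruent modulo $R(\mathbb{Z}^d)$. Let $N=\#B$. The attractor $T(R,B)$ is the unique nonempty compact set with $T(R,B)=\bigcup_{b\in B}\tau_b(T(R,B))$. The self-affine measure $\mu=\mu(R,B)$ is the unique Borel probability measure with $\mu(E)=\frac1N\sum_{b\in B}\mu(\tau_b^{-1}(E))$ for all Borel $E\subset\mathbb{R}^d$. Open set condition (OSC): there is a nonempty open set $U\subset\mathbb{R}^d$ with $\tau_b(U)\cap\tau_{b'}(U)=\emptyset$ for all $b\ne b'$ in $B$ and $\bigcup_{b\in B}\tau_b(U)\subset U$. Strong open set condition (SOSC): such a $U$ can be chosen with in addition $U\cap T(R,B)\neq\emptyset$. No-overlap condition: $\mu(\tau_b(T(R,B))\cap\tau_{b'}(T(R,B)))=0$ for all $b\neq b'$ in $B$. *)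

(* Defs.v *)
From mathcomp Require Import all_boot all_order all_algebra.
From mathcomp Require Import finmap complex.
From mathcomp Require Import all_classical all_reals all_analysis.

Set Implicit Arguments.
Unset Strict Implicit.
Unset Printing Implicit Defensive.

Import Order.TTheory GRing.Theory Num.Theory.
Import numFieldTopology.Exports numFieldNormedType.Exports.

Local Open Scope classical_set_scope.
Local Open Scope ring_scope.

Section SelfAffine.
Variables (K : realType) (d : nat).

(* The eigenvalues are the complex ones, whence the base change to K[i]; the
   norm on K[i] is the modulus, seen as an element of K[i]. *)
Definition expansive (A : 'M[int]_d) : Prop :=
  forall z : K[i], eigenvalue (map_mx intr A) z -> 1 < `|z|.

Definition simple_digit_set (A : 'M[int]_d) (B : {fset 'cV[int]_d}) : Prop :=
  forall b b', b \in B -> b' \in B -> b != b' ->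
    ~ exists k : 'cV[int]_d, b - b' = A *m k.

(* If A is expansive, then 0 is not an eigenvalue and invmx is a true inverse. *)
Definition tau (A : 'M[int]_d) (b : 'cV[int]_d) (x : 'cV[K]_d) : 'cV[K]_d :=
  invmx (map_mx intr A) *m (x + map_mx intr b).

Definition is_attractor (A : 'M[int]_d) (B : {fset 'cV[int]_d})
    (T : set 'cV[K]_d) : Prop :=
  [/\ T !=set0, compact T & T = \bigcup_(b in [set` B]) (tau A b @` T)].

Definition borel_space : measurableType _ :=
  g_sigma_algebraType (@open 'cV[K]_d).

Definition is_self_affine_measure (A : 'M[int]_d) (B : {fset 'cV[int]_d})
    (mu : probability borel_space K) : Prop :=
  forall E : set borel_space, measurable E ->
    mu E = ((#|` B|%:R^-1)%:E * \sum_(b <- B) mu (tau A b @^-1` E))%E.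

Definition osc_set (A : 'M[int]_d) (B : {fset 'cV[int]_d})
    (U : set 'cV[K]_d) : Prop :=
  [/\ open U, U !=set0,
      forall b b', b \in B -> b' \in B -> b != b' ->
        tau A b @` U `&` tau A b' @` U = set0
    & \bigcup_(b in [set` B]) (tau A b @` U) `<=` U].

Definition open_set_condition (A : 'M[int]_d) (B : {fset 'cV[int]_d}) : Prop :=
  exists U, osc_set A B U.

Definition strong_open_set_condition (A : 'M[int]_d) (B : {fset 'cV[int]_d})
    (T : set 'cV[K]_d) : Prop :=
  exists2 U, osc_set A B U & U `&` T !=set0.

Definition no_overlap (A : 'M[int]_d) (B : {fset 'cV[int]_d})
    (T : set 'cV[K]_d) (mu : probability borel_space K) : Prop :=
  forall b b', b \in B -> b' \in B -> b != b' ->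
    mu (tau A b @` T `&` tau A b' @` T) = 0%E.

End SelfAffine.

(* Main.v *)
Require Import Defs.
From mathcomp Require Import all_boot all_order all_algebra.
From mathcomp Require Import finmap complex.
From mathcomp Require Import all_classical all_reals all_analysis.
From mathcomp Require Import ring lra zify.

(* For digit words [v], [w] of the same length n, the cells [tau_v G] and
   [tau_w G] meet iff [G] and a translate of [G] by an integer vector
   [p_w - p_v] do. If [G] is bounded, only finitely many vectors occur this way,
   and since the digit set is simple, [v |-> p_v] is injective on words of a given
   length. So there is a word [w] with the most neighbours (Schief, Bandt-Graf),
   and prefixing [w] by [v] creates no neighbour not starting with [v].
   Taking for [G] a sublevel set of a norm contracted by [A^-1], so that
   [tau_b G] is contained in [G], the union [U] of the cells [tau_(v w) G] over all
   words [v] witnesses the (strong) open set condition.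
   For the overlap [E] of two pieces of [T], the cell [tau_(v w) G] misses [E] as soon
   as [v] is nonempty, and [mu] is carried by [G]. So the supremum [s] of
   [mu (tau_v^-1 E)] over nonempty [v] satisfies [s <= (1 - N^-|w|) s], hence is 0. *)

Set Implicit Arguments.
Unset Strict Implicit.
Unset Printing Implicit Defensive.

Import Order.TTheory GRing.Theory Num.Theory.
Import numFieldTopology.Exports numFieldNormedType.Exports.

Local Open Scope classical_set_scope.
Local Open Scope ring_scope.

(** * Exponential decay of the inverse powers of an expansive matrix *)

Lemma contraction_rate (C : numFieldType) (s : seq C) :
  (forall l, l \in s -> 1 < `|l|) ->
  exists2 q : C, 0 < q < 1 & forall l, l \in s -> 1 <= q * `|l|.
Proof.
elim: s => [_|l s IHs s1].
  by exists 2^-1 => //; rewrite invr_gt0 ltr0n invf_lt1 ?ltr0n ?ltr1n.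
have l1 : 1 < `|l| by apply: s1; rewrite mem_head.
have l0 : 0 < `|l| by apply: lt_trans l1.
have [|q /andP[q0 q1] qP] := IHs.
  by move=> x xs; apply: s1; rewrite in_cons xs orbT.
(* [C] is only partially ordered, but both elements are real, hence comparable; the larger one is
   the new rate. *)
have /orP[ql|lq] : (q <= `|l|^-1) || (`|l|^-1 <= q).
  by apply: real_leVge; apply: ger0_real; rewrite ?invr_ge0 ltW.
- exists `|l|^-1; first by rewrite invr_gt0 l0 invf_lt1.
  move=> x; rewrite in_cons => /predU1P[->|/qP]; first by rewrite mulVf ?gt_eqF.
  by move=> /le_trans; apply; apply: ler_wpM2r.
- exists q; first by rewrite q0 q1.
  move=> x; rewrite in_cons => /predU1P[->|/qP //].
  by rewrite -ler_pdivrMr// mul1r.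
Qed.

(* With [V_n = A^-n X] and [W_n = A^-n (A - l) X], one has
   [l V_(n+1) = V_n - W_(n+1)], so decay of [W] at rate [rho] passes to [V]. *)
Lemma split_poly_decay (C : numFieldType) (m : nat) (A Ai : 'M[C]_m.+1)
    (s : seq C) (q rho : C) :
  Ai * A = 1 -> 0 < q -> q < rho -> (forall l, l \in s -> 1 <= q * `|l|) ->
  forall X, \prod_(l <- s) (A - l%:M) * X = 0 ->
  exists2 D : C, 0 <= D & forall n i j, `|(Ai ^+ n * X) i j| <= D * rho ^+ n.
Proof.
move=> AiA q0 qrho; have rho0 : 0 < rho by apply: lt_trans qrho.
elim/last_ind: s => [_ X|s l IHs sP X].
  rewrite big_nil mul1r => ->; exists 0 => // n i j.
  by rewrite mulr0 mxE normr0 mul0r.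
rewrite -cats1 big_cat big_seq1 /= -mulrA => sX.
have {sX}[|D D0 WD] := IHs _ _ sX.
  by move=> x xs; apply: sP; rewrite mem_rcons in_cons xs orbT.
have ql : 1 <= q * `|l| by apply: sP; rewrite mem_rcons mem_head.
have d0 : 0 < rho - q by rewrite subr_gt0.
(* The bound [D' rho^n] passes from [n] to [n+1] as soon as [q D rho <= D' (rho - q)]; bounding the
   entries of [X] starts the induction. *)
have [D' D'D XD'] : exists2 D' : C,
    q * D * rho / (rho - q) <= D' & forall i j, `|X i j| <= D'.
  exists (q * D * rho / (rho - q) + \sum_i \sum_j `|X i j|).
    by rewrite lerDl sumr_ge0// => i _; rewrite sumr_ge0.
  move=> i j; rewrite (bigD1 i)//= (bigD1 j)//= addrCA -addrA lerDl.
  by rewrite !addr_ge0 ?sumr_ge0 ?divr_ge0 ?mulr_ge0 ?(ltW q0) ?(ltW rho0)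
    ?(ltW d0)// => k _; rewrite sumr_ge0.
exists D'; first by apply: le_trans D'D; rewrite divr_ge0 ?mulr_ge0// ltW.
elim=> [|n IHn] i j.
  by rewrite expr0 mul1r mulr1.
have WV : Ai ^+ n.+1 * ((A - l%:M) * X) = Ai ^+ n * X - l *: (Ai ^+ n.+1 * X).
  rewrite mulrA mulrBr exprSr -[_ * A]mulrA AiA mulr1 mulrBl; congr (_ - _).
  by rewrite -[_ * l%:M]/(_ *m _) mul_mx_scalar -scalerAl.
have lV : `|l| * `|(Ai ^+ n.+1 * X) i j| <= D' * rho ^+ n + D * rho ^+ n.+1.
  have := WD n.+1 i j; rewrite WV; move: (Ai ^+ n.+1 * X) => Y.
  rewrite [X in `|X| <= _ -> _]mxE [X in `|_ + X| <= _ -> _]mxE.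
  rewrite [X in `|_ - X| <= _ -> _]mxE => WY; rewrite -normrM.
  rewrite (le_trans _ (lerD (IHn i j) WY))//.
  by rewrite -[X in `|X| <= _](subKr ((Ai ^+ n * X) i j)) ler_normB.
have {}lV := ler_wpM2l (ltW q0) lV; rewrite mulrA in lV.
have := ler_wpM2r (normr_ge0 ((Ai ^+ n.+1 * X) i j)) ql.
rewrite mul1r => /le_trans/(_ lV)/le_trans; apply.
have : 0 <= (D' * (rho - q) - q * D * rho) * rho ^+ n.
  by rewrite mulr_ge0 ?exprn_ge0 ?(ltW rho0)// subr_ge0 -ler_pdivrMr.
have -> (a b c e : C) k : (a * (e - c) - c * b * e) * e ^+ k =
    a * e ^+ k.+1 - c * (a * e ^+ k + b * e ^+ k.+1).
  by rewrite !exprS; move: (e ^+ k) => u; ring.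
by rewrite subr_ge0.
Qed.

Lemma expansive_det_neq0 (K : realType) (d : nat) (A : 'M[int]_d) :
  expansive K A -> \det A != 0.
Proof.
move=> expA; apply/negP => /eqP A0.
have : \det (map_mx intr A : 'M[K[i]]_d) == 0 by rewrite det_map_mx A0 rmorph0.
move=> /det0P[v v0 vA]; suff /expA : eigenvalue (map_mx intr A) (0 : K[i]).
  by rewrite normr0 ltr10.
by apply/eigenvalueP; exists v; rewrite ?scale0r.
Qed.

Lemma expansive_unitmx (K : realType) (d : nat) (A : 'M[int]_d) :
  expansive K A -> (map_mx intr A : 'M[K]_d) \in unitmx.
Proof.
move=> expA; rewrite unitmxE det_map_mx unitfE intr_eq0.
exact: expansive_det_neq0 expA.
Qed.

(** By Cayley-Hamilton over [K[i]], the product of the [A - l] over the eigenvalues vanishes, so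
    [split_poly_decay] applies with [X = 1]. The constants found in [K[i]] are real and descend to
    [K]. *)
Lemma expansive_decay (K : realType) (d : nat) (A : 'M[int]_d) :
  expansive K A ->
  exists rho D : K, [/\ 0 < rho < 1, 0 <= D & forall n i j,
    `|(invmx (map_mx intr A : 'M[K]_d) ^+ n) i j| <= D * rho ^+ n].
Proof.
move=> expA; have := expansive_unitmx expA.
case: d => [|m] in A expA *.
  move=> _; exists 2^-1, 0; split=> [||n []//] //.
  by rewrite invr_gt0 ltr0n invf_lt1 ?ltr0n ?ltr1n.
set AK : 'M[K]_m.+1 := map_mx intr A => AKu.
have mapM n : map_mx (real_complex K) (invmx AK ^+ n) = invmx (map_mx intr A) ^+ n.
  rewrite rmorphXn /= map_invmx -map_mx_comp; congr (invmx _ ^+ _).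
  by apply/matrixP => i j; rewrite !mxE /= rmorph_int.
pose AC : 'M[K[i]]_m.+1 := map_mx intr A.
have [s charE] := closed_field_poly_normal (char_poly AC).
rewrite (monicP (char_poly_monic _)) scale1r in charE.
have [|q /andP[q0 q1] qP] := @contraction_rate _ s.
  by move=> l ls; apply: expA; rewrite eigenvalue_root_char charE root_prod_XsubC.
(* The midpoint leaves room on both sides: strictly above [q] for the decay estimate, strictly below
   1 for contraction. *)
have qh : q < (q + 1) / 2 by rewrite midf_lt.
have h1 : (q + 1) / 2 < 1.
  by rewrite -[ltRHS](@mulfK _ 2)// ltr_pM2r ?invr_gt0// mul1r ltrD2r.
have h0 : 0 < (q + 1) / 2 by apply: lt_trans qh.
have [| |D D0 DP] := @split_poly_decay _ _ AC (invmx AC) s q _ _ q0 qh qP 1.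
- have : AC \in unitmx.
    rewrite unitmxE /AC det_map_mx unitfE intr_eq0.
    exact: expansive_det_neq0 expA.
  exact: mulVmx.
- rewrite mulr1 -[RHS](Cayley_Hamilton AC) charE rmorph_prod /=.
  by apply: eq_bigr => l _; rewrite rmorphB /= horner_mx_X horner_mx_C.
have hR := RRe_real (gtr0_real h0); have DR := RRe_real (ger0_real D0).
exists (complex.Re ((q + 1) / 2)), (complex.Re D); split.
- by rewrite -!ltcR hR h0.
- by rewrite -lecR DR.
- move=> n i j; have := DP n i j; rewrite mulr1 -mapM mxE.
  rewrite -DR -hR -rmorphXn -rmorphM normc_def /= expr0n addr0 sqrtr_sqr.
  by rewrite lecR.
Qed.

(** * A norm contracted by the inverse matrix *)

Definition norm1 (K : realType) (d : nat) (x : 'cV[K]_d) : K := \sum_i `|x i 0|.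

Lemma norm1_mulmx (K : realType) (d : nat) (P : 'M[K]_d) (c : K) (x : 'cV[K]_d) :
  (forall i j, `|P i j| <= c) -> norm1 (P *m x) <= d%:R * c * norm1 x.
Proof.
move=> Pc; rewrite /norm1 -mulrA -[d in d%:R]card_ord mulr_natl -sumr_const.
apply: ler_sum => i _; rewrite mxE (le_trans (ler_norm_sum _ _ _))// mulr_sumr.
by apply: ler_sum => j _; rewrite normrM ler_wpM2r.
Qed.

(** Raising the rate from [q] to some [h < 1] absorbs the constant: [d D q^n <= h^n] for large
    [n]. *)
Lemma expansive_norm1 (K : realType) (d : nat) (A : 'M[int]_d) :
  expansive K A ->
  exists rho : K, exists2 n, 0 < rho < 1 & forall x : 'cV[K]_d,
    norm1 (invmx (map_mx intr A) ^+ n.+1 *m x) <= rho ^+ n.+1 * norm1 x.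
Proof.
move=> /expansive_decay[q [D [/andP[q0 q1] D0 DP]]].
pose h := (q + 1) / 2; have [qh h1] : q < h /\ h < 1 by rewrite /h; split; lra.
have h0 : 0 < h by apply: lt_trans qh.
have qh0 : 0 <= q / h by rewrite divr_ge0 ?ltW.
have : (fun n => (q / h) ^+ n) @ \oo --> (0 : K).
  by apply: cvg_expr; rewrite ger0_norm// ltr_pdivrMr// mul1r.
(* The [+ 1] keeps the denominator positive when [d D = 0]. *)
have c0 : 0 < (d%:R * D + 1)^-1 by rewrite invr_gt0 ltr_wpDl ?mulr_ge0.
move=> /cvgrPdist_lt/(_ _ c0)[n _ /(_ n.+1 (leqnSn n))].
rewrite /= sub0r normrN ger0_norm ?exprn_ge0// => hn.
exists h, n; first by rewrite h0.
move=> x; apply: le_trans (norm1_mulmx _ (DP n.+1)) _.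
apply: ler_wpM2r; first by rewrite /norm1 sumr_ge0.
have : (d%:R * D + 1) * (q / h) ^+ n.+1 <= 1.
  by rewrite mulrC -ler_pdivlMr ?mul1r ?ltW// ltr_wpDl ?mulr_ge0.
rewrite expr_div_n [X in X <= 1 -> _]mulrA ler_pdivrMr ?exprn_gt0// mul1r.
apply: le_trans.
by rewrite mulrA ler_wpM2r ?exprn_ge0 ?(ltW q0)// lerDl.
Qed.

Lemma matrix_continuous (X : topologicalType) (K : numFieldType) (m n : nat)
    (f : X -> 'M[K]_(m, n)) :
  (forall i j, continuous (fun x => f x i j)) -> continuous f.
Proof.
move=> cf x V [P Px PV]; rewrite /nbhs /=.
have : \forall y \near x, forall i j, P i j (f y i j).
  by apply: filter_forall => i; apply: filter_forall => j; exact: (cf i j x _ (Px i j)).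
by apply: filterS => y Py; apply: PV.
Qed.

Lemma sum_continuous (X : topologicalType) (K : numFieldType) (I : Type)
    (r : seq I) (f : I -> X -> K) :
  (forall i, continuous (f i)) -> continuous (fun x => \sum_(i <- r) f i x).
Proof.
move=> cf x; elim: r => [|i r IHr].
  rewrite (_ : (fun _ => _) = cst 0); first exact: cvg_cst.
  by apply/funext => y; rewrite big_nil.
rewrite (_ : (fun _ => _) = (fun y => f i y + \sum_(j <- r) f j y)).
  by apply: cvgD => //; exact: cf.
by apply/funext => y; rewrite big_cons.
Qed.

Lemma cstM_continuous (X : topologicalType) (K : numFieldType) (c : K) (f : X -> K) :
  continuous f -> continuous (fun x => c * f x).
Proof. by move=> cf x; exact: (cvgM (cvg_cst c) (cf x)). Qed.

Lemma mulmx_coord_continuous (K : realType) (d : nat) (P : 'M[K]_d) i j :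
  continuous (fun x : 'cV[K]_d => (P *m x) i j).
Proof.
under eq_fun do rewrite mxE.
by apply: sum_continuous => k; apply: cstM_continuous; exact: coord_continuous.
Qed.

Lemma affine_continuous (K : realType) (d : nat) (P : 'M[K]_d) (q : 'cV[K]_d) :
  continuous (fun x : 'cV[K]_d => P *m x + q).
Proof.
apply: matrix_continuous => i j; under eq_fun do rewrite mxE.
by move=> x; exact: (cvgD (@mulmx_coord_continuous _ _ P i j x) (cvg_cst _)).
Qed.

(* For [rho] and [n] as in [expansive_norm1] the norm
   [\sum_(k <= n) rho^-k |A^-k x|] is contracted by [A^-1] in one step. *)
Lemma adapted_norm (K : realType) (d : nat) (A : 'M[int]_d) : expansive K A ->
  exists phi : 'cV[K]_d -> K, exists rho : K,
  [/\ 0 < rho < 1, continuous phi, (forall x y, phi (x + y) <= phi x + phi y),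
      (forall (x : 'cV[K]_d) i, `|x i 0| <= phi x) &
      forall x, phi (invmx (map_mx intr A) *m x) <= rho * phi x].
Proof.
move=> /expansive_norm1[rho [n rho01 nP]]; set M := invmx _ in nP *.
have /andP[rho0 _] := rho01.
have N0 (x : 'cV[K]_d) : 0 <= norm1 x by rewrite /norm1 sumr_ge0.
have r0 k : 0 <= rho ^- k by rewrite invr_ge0 exprn_ge0 ?ltW.
exists (fun x => \sum_(k < n.+1) rho ^- k * norm1 (M ^+ k *m x)), rho.
split=> //.
- apply: sum_continuous => k; apply: cstM_continuous.
  apply: sum_continuous => i x.
  exact: (cvg_norm (@mulmx_coord_continuous _ _ _ _ _ x)).
- move=> x y; rewrite -big_split /=; apply: ler_sum => k _.
  rewrite -mulrDr ler_wpM2l// mulmxDr /norm1 -big_split /=.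
  by apply: ler_sum => i _; rewrite mxE ler_normD.
- move=> x i; rewrite big_ord_recl /= !expr0 invr1 mul1r -[1]/(1%:M) mul1mx.
  rewrite -[leLHS]addr0; apply: lerD.
    by rewrite /norm1 (bigD1 i)//= lerDl sumr_ge0.
  by rewrite sumr_ge0// => k _; rewrite mulr_ge0.
(* The last summand on the left is bounded by the first on the right through [nP]; the others agree
   after a shift of index. *)
- move=> x; rewrite mulr_sumr big_ord_recr big_ord_recl addrC /=.
  apply: lerD; last first.
    rewrite mulmxA -[_ *m M]/(_ * M) -exprSr ler_pdivrMl ?exprn_gt0//.
    rewrite !expr0 invr1 !mul1r -[1]/(1%:M) mul1mx mulrA -exprSr; exact: nP.
  apply: ler_sum => k _; rewrite mulmxA -[_ *m M]/(_ * M) -exprSr /=.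
  rewrite /bump add1n mulrA [rho ^+ _.+1]exprS invfM mulrA mulfV ?gt_eqF// mul1r.
  exact: lexx.
Qed.

Lemma fset_bounded (K : realDomainType) (T : choiceType) (B : {fset T}) (f : T -> K) :
  exists2 r, 0 <= r & forall b, b \in B -> f b <= r.
Proof.
exists (\sum_(b <- B) `|f b|); first by rewrite sumr_ge0.
move=> b bB; rewrite (big_fsetD1 b)//= (le_trans (ler_norm _))// lerDl.
by rewrite sumr_ge0.
Qed.

(** * Digit words, their positions and their neighbours *)

Section Words.
Variables (K : realType) (d : nat) (A : 'M[int]_d) (B : {fset 'cV[int]_d}).

Definition tauw (v : seq 'cV[int]_d) (x : 'cV[K]_d) : 'cV[K]_d :=
  foldr (tau A) x v.

(** The integer vector with digits [v] in base [A], leading digit first, by Horner's rule. *)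
Definition pos (v : seq 'cV[int]_d) : 'cV[int]_d :=
  foldl (fun p b => A *m p + b) 0 v.

Lemma tauw_cat v w x : tauw (v ++ w) x = tauw v (tauw w x).
Proof. exact: foldr_cat. Qed.

Lemma pos_rcons v b : pos (rcons v b) = A *m pos v + b.
Proof. by rewrite /pos foldl_rcons. Qed.

Lemma pos_catB v w w' : size w = size w' ->
  pos (v ++ w) - pos (v ++ w') = pos w - pos w'.
Proof.
elim/last_ind: w w' => [|w b IHw] w'; first by move=> /esym/size0nil ->; rewrite !subrr.
case/lastP: w' => [|w' b']; first by rewrite size_rcons.
rewrite !size_rcons => -[/IHw ww'].
have posB p q : A *m p + b - (A *m q + b') = A *m (p - q) + (b - b').
  by rewrite mulmxBr opprD addrACA.
by rewrite -!rcons_cat !pos_rcons !posB ww'.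
Qed.

Hypothesis expA : expansive K A.

Lemma tauwE v x :
  tauw v x = invmx (map_mx intr A) ^+ size v *m (x + map_mx intr (pos v)).
Proof.
elim/last_ind: v x => [|v b IHv] x.
  by rewrite expr0 /= -[1]/(1%:M) mul1mx map_mx0 addr0.
rewrite -cats1 tauw_cat IHv cats1 size_rcons exprSr /= /tau -[_ * _]/(_ *m _).
rewrite -mulmxA pos_rcons; congr (_ *m _).
rewrite map_mxD map_mxM [in RHS](addrC (_ *m _)) addrA [RHS]mulmxDr.
by rewrite (mulKmx (expansive_unitmx expA)).
Qed.

Lemma tauw_eq u w x y : size u = size w -> tauw u x = tauw w y ->
  x + map_mx intr (pos u) = y + map_mx intr (pos w).
Proof.
move=> uw; rewrite !tauwE uw; set P := _ ^+ _.
have Pu : P \in unitmx.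
  rewrite /P; elim: (size w) => [|n IHn]; first exact: unitmx1.
  by rewrite exprS unitmx_mul unitmx_inv (expansive_unitmx expA).
by move/(can_inj (mulKmx Pu)).
Qed.

Hypothesis simpleB : simple_digit_set A B.

(** The last digit is determined by the position modulo [A], since the digit set is simple; the
    remaining digits follow by induction. *)
Lemma pos_inj u v : {subset u <= B} -> {subset v <= B} -> size u = size v ->
  pos u = pos v -> u = v.
Proof.
elim/last_ind: u v => [|u b IHu] v; first by move=> _ _ /esym/size0nil.
case/lastP: v => [|v c]; first by rewrite size_rcons.
move=> ubB vcB; rewrite !size_rcons !pos_rcons => -[uv] pp.
have bc : b = c.
  apply/eqP; apply: contraT => bc.
  have [] := simpleB (ubB b _) (vcB c _) bc; rewrite ?mem_rcons ?mem_head//.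
  exists (pos v - pos u); rewrite mulmxBr.
  have -> : A *m pos v = A *m pos u + b - c by rewrite pp addrK.
  by rewrite -[_ + b - c]addrA [RHS]addrAC subrr add0r.
move: pp; rewrite bc => /addIr pp; congr rcons; apply: IHu => //.
- by move=> x xu; apply: ubB; rewrite mem_rcons in_cons xu orbT.
- by move=> x xu; apply: vcB; rewrite mem_rcons in_cons xu orbT.
(* [A] need not be invertible over the integers; it is cancelled by means of its adjugate and
   [\det A != 0]. *)
have A0 := expansive_det_neq0 expA.
have : \adj A *m (A *m pos u) = \adj A *m (A *m pos v) by rewrite pp.
rewrite !mulmxA !mul_adj_mx !mul_scalar_mx => /matrixP e.
apply/matrixP => i j; have := e i j; rewrite !mxE; exact: mulfI.
Qed.

Variable G : set 'cV[K]_d.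

(** A neighbour is recorded by its displacement rather than by its word, so that words of different
    lengths can be compared. *)
Definition neighbour (w : seq 'cV[int]_d) (t : 'cV[int]_d) : Prop :=
  exists2 u, {subset u <= B} /\ size u = size w &
    t = pos u - pos w /\ exists x y, [/\ G x, G y & tauw u x = tauw w y].

(** [tauw v] carries a common point of two cells to a common point of their images, and a common
    prefix cancels in the displacement. *)
Lemma neighbour_cat v w : {subset v <= B} -> neighbour w `<=` neighbour (v ++ w).
Proof.
move=> vB t [u [uB uw] [-> [x [y [Gx Gy xy]]]]]; exists (v ++ u).
  split; last by rewrite !size_cat uw.
  by move=> c; rewrite mem_cat => /orP[/vB|/uB].
by split; [rewrite pos_catB|exists x, y; rewrite !tauw_cat xy].
Qed.

Hypothesis bndG : exists M : K, forall x, G x -> forall i, `|x i 0| <= M.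

(** A displacement is a difference of two points of [G], so it is an integer vector in a fixed box.
    The box is encoded by matrices over ['I_(2m+1)], shifted by [m]. *)
Lemma neighbour_finite : exists F : {fset 'cV[int]_d},
  forall w t, neighbour w t -> t \in F.
Proof.
have [M GM] := bndG.
pose m := Num.bound (M + M).
exists [fset map_mx (fun k : 'I_(m.*2.+1) => k%:Z - m%:Z) s | s in 'cV_d]%fset.
move=> w t [u [_ uw] [-> [x [y [Gx Gy /(tauw_eq uw) xy]]]]].
set t' := pos u - pos w.
have tE i : `|t' i 0| <= m%:Z.
  have : (t' i 0)%:~R = y i 0 - x i 0.
    move/matrixP: xy => /(_ i 0); rewrite !mxE rmorphB /= => /eqP.
    by rewrite addrC -subr_eq eq_sym => /eqP; lra.
  move=> tE; rewrite -(ler_int K) intr_norm tE.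
  have /ltW := archi_boundP (addr_ge0 (le_trans (normr_ge0 _) (GM _ Gx i))
    (le_trans (normr_ge0 _) (GM _ Gx i))).
  apply: le_trans; apply: le_trans (ler_normB _ _) _.
  by apply: lerD; exact: GM.
clearbody t'; apply/imfsetP; exists (\col_i inord (absz (t' i 0 + m%:Z))) => //.
apply/matrixP => i j; rewrite (ord1 j) !mxE.
have := tE i; rewrite ler_norml => /andP[t1 t2].
move: (t' i 0 : int) t1 t2 => z {}t1 t2.
have z0 : 0 <= z + m%:Z by lia.
by rewrite inordK; lia.
Qed.

(* Schief's maximality argument: a word [w] with the most neighbours passes
   exactly these on to every [v ++ w], so all neighbours of [v ++ w] begin
   with [v]. *)
Lemma separating_word : exists2 w, {subset w <= B} &
  forall b c v u x y, {subset b :: v <= B} -> {subset c :: u <= B} ->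
    size u = size (v ++ w) -> G x -> G y ->
    tauw (b :: v ++ w) x = tauw (c :: u) y -> b = c.
Proof.
have [F FP] := neighbour_finite.
pose D w := [fset t in F | `[< neighbour w t >]]%fset.
have DP w t : t \in D w = `[< neighbour w t >].
  rewrite !inE /=; case: asboolP => [/FP ->|]; by rewrite ?andbF.
pose P k := `[< exists2 w, {subset w <= B} & #|` D w| = k >].
have exP : exists k, P k by exists #|` D [::]|; apply/asboolP; exists [::].
have ubP k : P k -> (k <= #|` F|)%N.
  by move=> /asboolP[w _ <-]; apply: fsubset_leq_card; apply: fset_sub.
case: (ex_maxnP exP ubP) => _ /asboolP[w wB <-] wmax; exists w => //.
move=> b c v u x y bvB cuB uvw Gx Gy e.
have DD : D w = D ((b :: v) ++ w).
  apply/eqP; rewrite eqEfcard; apply/andP; split.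
    by apply/fsubsetP => t; rewrite !DP => /asboolP/(neighbour_cat bvB) ?; exact/asboolP.
  apply: wmax; apply/asboolP; exists ((b :: v) ++ w) => //.
  by move=> z; rewrite mem_cat => /orP[/bvB|/wB].
have : pos (c :: u) - pos ((b :: v) ++ w) \in D ((b :: v) ++ w).
  rewrite DP; apply/asboolP; exists (c :: u); first by rewrite /= uvw.
  by split=> //; exists y, x.
(* The displacement already occurs at [w], for some [u']. Then [c :: u] and [(b :: v) ++ u'] have
   the same length and position, so they coincide. *)
rewrite -DD DP => /asboolP[u' [u'B u'w] [+ _]].
rewrite -(pos_catB (b :: v) u'w) => /addIr /pos_inj.
move=> pI; suff [-> _] : c :: u = (b :: v) ++ u' by [].
apply: pI => //; first by move=> z; rewrite mem_cat => /orP[/bvB|/u'B].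
by rewrite /= uvw !size_cat u'w.
Qed.
End Words.

(** * A bounded region that the maps send into itself *)

(** Since [phi (tau A b x) <= rho (phi x + phi b)], going back along [tau A b] from a level [s >= r]
    raises [phi] by at least 1. Hence [phi < r] is stable under the maps, and backward orbits
    outside it escape. *)
Lemma lyapunov_function (K : realType) (d : nat) (A : 'M[int]_d)
    (B : {fset 'cV[int]_d}) (T : set 'cV[K]_d) :
  expansive K A -> compact T ->
  exists phi : 'cV[K]_d -> K, exists r : K,
  [/\ continuous phi, phi 0 < r, (forall (x : 'cV[K]_d) i, `|x i 0| <= phi x),
      (forall b x s, b \in B -> r <= s -> s <= phi (tau A b x) -> s + 1 <= phi x) &
      forall x, T x -> phi x < r].
Proof.
move=> expA cT.
have [phi [rho [/andP[rho0 rho1] cphi phiD phige phiM]]] := adapted_norm expA.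
have [RT RTP] : exists RT, forall x, T x -> phi x <= RT.
  have /compact_bounded[N [_ NP]] : compact (phi @` T).
    by apply: continuous_compact => //; apply: continuous_subspaceT.
  exists (N + 1) => x Tx; apply: le_trans (ler_norm _) _.
  by apply: (NP (N + 1)); [rewrite ltrDl|exists x].
(* For [s] above this threshold, [rho (s + 1 + phi b) <= s]. *)
have [RB RB0 RBP] := fset_bounded B
  (fun b => rho * (1 + phi (map_mx intr b)) / (1 - rho)).
exists phi, (RB + `|RT| + `|phi 0| + 1); split=> //.
- by have := ler_norm (phi 0); have := normr_ge0 RT; lra.
- move=> b x s /RBP RBb rs sphi; rewrite leNgt; apply/negP => phis.
  have RBs : RB <= s by have := normr_ge0 (phi 0); have := normr_ge0 RT; lra.
  move: RBb; rewrite ler_pdivrMr ?subr_gt0// => RBb.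
  have := le_trans sphi (phiM _) => /le_trans/(_ (ler_wpM2l (ltW rho0) (phiD _ _))).
  apply/negP; rewrite -ltNge.
  have : rho * (phi x + phi (map_mx intr b)) < rho * (s + 1 + phi (map_mx intr b)).
    by rewrite ltr_pM2l// ltrD2r.
  have : RB * (1 - rho) <= s * (1 - rho) by rewrite ler_pM2r ?subr_gt0.
  move: (phi (map_mx intr b)) RBb => y; lra.
- by move=> x /RTP; have := ler_norm RT; have := normr_ge0 (phi 0); lra.
Qed.

(** * Construction of the open set *)

Section OpenSet.
Variables (K : realType) (d : nat) (A : 'M[int]_d) (B : {fset 'cV[int]_d}).
Hypothesis expA : expansive K A.

Lemma tau_continuous b : continuous (@tau K d A b).
Proof.
rewrite (_ : tau A b = fun x => invmx (map_mx intr A) *m x +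
  invmx (map_mx intr A) *m map_mx intr b); first exact: affine_continuous.
by apply/funext => x; rewrite /tau mulmxDr.
Qed.

Lemma tauw_continuous v : continuous (@tauw K d A v).
Proof.
elim: v => [|b v IHv] x; first exact: cvg_id.
by apply: continuous_comp; [exact: IHv|exact: tau_continuous].
Qed.

Lemma tau_image_open b (U : set 'cV[K]_d) : open U -> open (tau A b @` U).
Proof.
have uA := expansive_unitmx expA.
rewrite (_ : tau A b @` U =
  (fun y => map_mx intr A *m y + - map_mx intr b) @^-1` U).
  by move=> oU; apply: open_comp => // x _; exact: affine_continuous.
apply/seteqP; split=> [_ [x Ux <-]|y Uy] /=.
  by rewrite /tau mulKVmx// addrK.
by eexists; first exact: Uy; rewrite /tau subrK mulKmx.
Qed.

Lemma tauw_image_open v (U : set 'cV[K]_d) : open U -> open (tauw A v @` U).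
Proof.
move=> oU; elim: v => [|b v IHv]; first by rewrite (_ : _ @` _ = U) // image_id.
rewrite (_ : _ @` _ = tau A b @` (tauw A v @` U)); first exact: tau_image_open.
by rewrite image_comp.
Qed.

Lemma attractor_tauw (T : set 'cV[K]_d) v x : is_attractor A B T ->
  {subset v <= B} -> T x -> T (tauw A v x).
Proof.
move=> [_ _ TE]; elim: v => [//|b v IHv] vB Tx; rewrite TE.
exists b; first by apply: vB; rewrite mem_head.
by exists (tauw A v x) => //; apply: IHv => // c cv; apply: vB; rewrite in_cons cv orbT.
Qed.

Lemma attractor_word (T : set 'cV[K]_d) n x : is_attractor A B T -> T x ->
  exists u, [/\ {subset u <= B}, size u = n & exists2 y, T y & x = tauw A u y].
Proof.
move=> [_ _ TE]; elim: n x => [|n IHn] x Tx; first by exists [::]; split=> //; exists x.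
move: (Tx); rewrite {1}TE => -[b bB [y /IHn[u [uB un [z Tz ->]]] <-]].
exists (b :: u); split; [|by rewrite /= un|by exists z].
by move=> c; rewrite in_cons => /predU1P[->|/uB].
Qed.

Hypothesis simpleB : simple_digit_set A B.
Variable G : set 'cV[K]_d.
Hypotheses (oG : open G) (G0 : G !=set0).
Hypothesis bndG : exists M : K, forall x, G x -> forall i, `|x i 0| <= M.
Hypothesis tauG : forall b x, b \in B -> G x -> G (tau A b x).

Lemma tauw_stable v x : {subset v <= B} -> G x -> G (tauw A v x).
Proof.
elim: v => [//|b v IHv] vB Gx; apply: tauG; first by apply: vB; rewrite mem_head.
by apply: IHv => // c cv; apply: vB; rewrite in_cons cv orbT.
Qed.

(** Prefixing a letter permutes cells of the union into cells of the union, whence stability; the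
    separating word gives disjointness. [U] meets [T] because [tauw A w] maps [G] into [U] and [T]
    into [T]. *)
Lemma osc_set_exists : exists2 U, osc_set A B U &
  forall T, is_attractor A B T -> G `&` T !=set0 -> U `&` T !=set0.
Proof.
have [w wB wP] := separating_word expA simpleB bndG.
pose U := \bigcup_(v in [set v : seq 'cV[int]_d | {subset v <= B}])
  (tauw A (v ++ w) @` G).
(* The longer word is cut to the length of the shorter one; the letters cut off move the point [y]
   within [G]. *)
have sep b c v u x y : b \in B -> c \in B -> {subset v <= B} -> {subset u <= B} ->
    (size v <= size u)%N -> G x -> G y ->
    tau A b (tauw A (v ++ w) x) = tau A c (tauw A (u ++ w) y) -> b = c.
  move=> bB cB vB uB vu Gx Gy e.
  have uwB z : z \in u ++ w -> z \in B by rewrite mem_cat => /orP[/uB|/wB].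
  have vwu : (size (v ++ w) <= size (u ++ w))%N by rewrite !size_cat leq_add2r.
  apply: (wP b c v (take (size (v ++ w)) (u ++ w)) x
    (tauw A (drop (size (v ++ w)) (u ++ w)) y)) => //.
  - by move=> z; rewrite in_cons => /predU1P[->|/vB].
  - by move=> z; rewrite in_cons => /predU1P[->//|/mem_take/uwB].
  - by rewrite size_takel.
  - by apply: tauw_stable => // z /mem_drop/uwB.
  - by rewrite /= -tauw_cat cat_take_drop.
exists U; last first.
  move=> T attT [x [Gx Tx]]; exists (tauw A w x); split.
    by exists [::] => //; exists x.
  exact: attractor_tauw.
split.
- by apply: bigcup_open => v _; apply: tauw_image_open.
- by have [x Gx] := G0; exists (tauw A w x); exists [::] => //; exists x.
- move=> b c bB cB /eqP bc; rewrite -subset0 => z /= [].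
  move=> [_ [v vB [x Gx <-]] <-] [_ [u uB [y Gy <-]] e]; apply: bc.
  have [vu|/ltnW uv] := leqP (size v) (size u).
    exact: (sep b c v u x y).
  by apply/esym; exact: (sep c b u v y x).
- move=> _ [b bB [_ [v vB [x Gx <-]] <-]]; exists (b :: v); last by exists x.
  by move=> z; rewrite in_cons => /predU1P[->|/vB].
Qed.
End OpenSet.

(** * Averaging functions on the tree of words *)

Section Averaging.
Variables (K : realType) (X : choiceType) (B : {fset X}) (f : seq X -> K).
Hypothesis avgf : forall v, f v = #|` B|%:R^-1 * \sum_(b <- B) f (rcons v b).

(** Of the [N] children of [v], one lies on the path [w] to a zero and the others are at most [s]:
    [((1 - N^-k) s + (N - 1) s) / N = (1 - N^-(k+1)) s]. *)
Lemma averaging_step (s : K) :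
  (forall v, v != [::] -> {subset v <= B} -> f v <= s) ->
  forall w v, {subset w <= B} -> v != [::] -> {subset v <= B} -> f (v ++ w) = 0 ->
    f v <= (1 - #|` B|%:R ^- size w) * s.
Proof.
move=> fs; elim=> [|b w IHw] v wB v0 vB.
  by rewrite cats0 => ->; rewrite expr0 invr1 subrr mul0r.
rewrite -cat_rcons => fvw.
have bB : b \in B by apply: wB; rewrite mem_head.
have N0 : 0 < #|` B|%:R :> K by rewrite ltr0n cardfs_gt0; apply/fset0Pn; exists b.
have vcB c : c \in B -> {subset rcons v c <= B}.
  by move=> cB x; rewrite mem_rcons in_cons => /predU1P[->|/vB].
have vc0 c : rcons v c != [::] by case: (v).
rewrite avgf ler_pdivrMl// (big_fsetD1 b)//=.
have fb : f (rcons v b) <= (1 - #|` B|%:R ^- size w) * s.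
  by apply: IHw => //; [move=> c cw; apply: wB; rewrite in_cons cw orbT|exact: vcB].
have fc : \sum_(c <- (B `\ b)%fset) f (rcons v c) <= (#|` B|%:R - 1) * s.
  have -> : (#|` B|%:R - 1) * s = \sum_(c <- (B `\ b)%fset) s.
    by rewrite big_const_seq count_predT iter_addr_0 (cardfsD1 b) bB natrD
      addrAC subrr add0r mulr_natl.
  rewrite big_seq [leRHS]big_seq; apply: ler_sum => c; rewrite in_fsetD1 => /andP[_ cB].
  by apply: fs => //; exact: vcB.
apply: le_trans (lerD fb fc) _; rewrite exprS invfM.
rewrite le_eqVlt; apply/orP; left; apply/eqP.
by field; rewrite expf_neq0 gt_eqF.
Qed.

(** With [s] the supremum over nonempty words, the previous bound forces [s <= 0]; the value at the
    empty word is an average of values at one-letter words. *)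
Lemma averaging_vanishes (w : seq X) :
  {subset w <= B} -> (forall v, 0 <= f v <= 1) ->
  (forall v, v != [::] -> {subset v <= B} -> f (v ++ w) = 0) -> f [::] = 0.
Proof.
move=> wB f01 fw; have [B0|/fset0Pn[b bB]] := eqVneq B fset0.
  by rewrite avgf B0 big_seq_fset0 mulr0.
pose S := [set f v | v in [set v | v != [::] /\ {subset v <= B}]].
have supS : has_sup S.
  split; last by exists 1 => _ [v _ <-]; have /andP[] := f01 v.
  by exists (f [:: b]), [:: b] => //; split=> // c; rewrite inE => /eqP ->.
have fs v : v != [::] -> {subset v <= B} -> f v <= sup S.
  by move=> v0 vB; apply: ub_le_sup; [exact: supS.2|exists v].
have N0 : 0 < #|` B|%:R :> K by rewrite ltr0n cardfs_gt0; apply/fset0Pn; exists b.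
have s0 : sup S <= 0.
  have : sup S <= (1 - #|` B|%:R ^- size w) * sup S.
    apply: ge_sup; first exact: supS.1.
    by move=> _ [v [v0 vB] <-]; apply: averaging_step => //; exact: fw.
  rewrite mulrBl mul1r lerBrDr gerDl pmulr_rle0//.
  by rewrite invr_gt0 exprn_gt0.
apply/eqP; rewrite eq_le; have /andP[-> _] := f01 [::]; rewrite andbT avgf.
rewrite pmulr_rle0 ?invr_gt0// big_seq sumr_le0// => c cB.
by apply: le_trans s0; apply: fs => // z; rewrite inE => /eqP ->.
Qed.
End Averaging.

(** * Where the self-affine measure is carried *)

Section Measure.
Variables (K : realType) (d : nat) (A : 'M[int]_d) (B : {fset 'cV[int]_d}).
Variable mu : probability (borel_space K d) K.
Hypothesis affmu : is_self_affine_measure A B mu.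

Lemma closed_borel (F : set 'cV[K]_d) :
  closed F -> measurable (F : set (borel_space K d)).
Proof.
move=> cF; rewrite -(setCK F); apply: measurableC.
by apply: sub_sigma_algebra; exact: closed_openC.
Qed.

Lemma closed_borel_fin (F : set 'cV[K]_d) : closed F -> mu F = (fine (mu F))%:E.
Proof. by move=> cF; rewrite fineK// fin_num_measure//; exact: closed_borel. Qed.

Lemma tau_preimage_closed b (F : set 'cV[K]_d) : closed F -> closed (tau A b @^-1` F).
Proof. by move=> cF; apply: preimage_closed => // x _; exact: tau_continuous. Qed.

Lemma self_affine_fine (F : set 'cV[K]_d) : closed F ->
  fine (mu F) = #|` B|%:R^-1 * \sum_(b <- B) fine (mu (tau A b @^-1` F)).
Proof.
move=> cF; rewrite affmu; last exact: closed_borel.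
rewrite (eq_bigr (fun b => (fine (mu (tau A b @^-1` F)))%:E)); last first.
  by move=> b _; apply: closed_borel_fin; exact: tau_preimage_closed.
by rewrite sumEFin -EFinM.
Qed.

Lemma self_affine_card_gt0 : (0 < #|` B|)%N.
Proof.
rewrite lt0n; apply/negP => /eqP N0.
(* For empty [B] the factor [0^-1] is 0 by convention, and the whole space would have measure 0. *)
have := affmu measurableT; rewrite N0 invr0 mul0e => /eqP.
by rewrite probability_setT gt_eqF.
Qed.

(** [tau A b] pulls [H k] back into [H k.+1], so by self-affinity [mu (H k)] is nondecreasing in
    [k]; but the [H k] decrease to the empty set. *)
Lemma self_affine_confined (phi : 'cV[K]_d -> K) (r : K) : continuous phi ->
  (forall b x s, b \in B -> r <= s -> s <= phi (tau A b x) -> s + 1 <= phi x) ->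
  mu [set x | r <= phi x] = 0%E.
Proof.
move=> cphi phiP; pose H (k : nat) : set (borel_space K d) := [set x | r + k%:R <= phi x].
have cH k : closed (H k : set 'cV[K]_d).
  apply: (@preimage_closed _ _ phi [set y | r + k%:R <= y]); last exact: closed_ge.
  by move=> x _; exact: cphi.
have mH k : measurable (H k) by apply: closed_borel.
have N0 := self_affine_card_gt0.
have HS k : (mu (H k) <= mu (H k.+1))%E.
  rewrite closed_borel_fin// [leRHS]closed_borel_fin// lee_fin self_affine_fine//.
  rewrite ler_pdivrMl ?ltr0n// mulr_natl -iter_addr_0 -(count_predT B) -big_const_seq.
  rewrite big_seq [leRHS]big_seq; apply: ler_sum => b bB.
  rewrite -lee_fin -!closed_borel_fin//; last exact: tau_preimage_closed.
  apply: le_measure; rewrite ?inE//.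
    by apply: closed_borel; exact: tau_preimage_closed.
  move=> x /= /(phiP _ _ _ bB); rewrite /H /= -natr1 addrA; apply.
  by rewrite lerDl.
have H0 k : (mu (H 0%N) <= mu (H k))%E by elim: k => // k /le_trans; apply.
have capH : \bigcap_k H k = set0.
  rewrite -subset0 => x Hx; have := Hx (Num.bound `|phi x - r|) I.
  rewrite /H /= addrC -lerBrDr leNgt => /negP; apply.
  by apply: le_lt_trans (ler_norm _) _; apply: archi_boundP.
have : (mu \o H) x @[x --> \oo] --> mu (\bigcap_k H k).
  apply: nonincreasing_cvg_mu => //.
  - by rewrite (le_lt_trans (probability_le1 _ _)) ?ltry.
  - by rewrite capH.
  - move=> m n mn; apply/subsetPset => x; rewrite /H /=; apply: le_trans.
    by rewrite lerD2l ler_nat.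
rewrite capH measure0 => cvH; apply/eqP; rewrite eq_le measure_ge0 andbT.
have -> : [set x | r <= phi x] = H 0%N by apply/seteqP; split=> x; rewrite /H /= addr0.
rewrite -(cvg_lim _ cvH)//; apply: lime_ge; first by apply/cvg_ex; exists 0%E.
by near=> k; exact: H0.
Unshelve. all: by end_near. Qed.

End Measure.

(** * Vanishing of the overlap, and the theorem *)

Lemma no_overlap_of_separating (K : realType) (d : nat) (A : 'M[int]_d)
    (B : {fset 'cV[int]_d}) (T : set 'cV[K]_d) (mu : probability (borel_space K d) K) :
  expansive K A -> simple_digit_set A B -> is_attractor A B T ->
  is_self_affine_measure A B mu -> no_overlap A B T mu.
Proof.
move=> expA simpleB attT affmu b b' bB b'B bb'.
have [_ cT _] := attT.
have [phi [r [cphi _ phige phiP TG]]] := lyapunov_function B expA cT.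
have bndG : exists M : K, forall x, [set x | phi x < r] x -> forall i, `|x i 0| <= M.
  by exists r => x /ltW phir i; apply: le_trans (phige x i) phir.
have [w wB wP] := separating_word expA simpleB bndG.
have ctauT c : closed (tau A c @` T).
  apply: compact_closed; first exact: norm_hausdorff.
  apply: continuous_compact => //; apply: continuous_subspaceT.
  exact: tau_continuous.
set E := _ `&` _.
have cE v : closed (tauw A v @^-1` E).
  apply: preimage_closed; last exact: closedI.
  by move=> x _; exact: tauw_continuous.
have /(closed_borel_fin mu) -> : closed E := cE [::].
suff -> : fine (mu E) = 0 by [].
pose f v := fine (mu (tauw A v @^-1` E)).
apply: (@averaging_vanishes _ _ B f _ w) => //.
(* Letters are appended on the right because the preimage under [tauw A (rcons v c)] is that under
   [tau A c] of the one under [tauw A v]. *)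
- move=> v; rewrite /f (self_affine_fine affmu)//; congr (_ * _).
  apply: eq_bigr => c _; congr (fine (mu _)).
  by apply/seteqP; split=> x /=; rewrite -cats1 tauw_cat.
- move=> v; rewrite /f fine_ge0//= -lee_fin -closed_borel_fin//.
  by apply: probability_le1; exact: closed_borel.
- case=> // c v _ cvB; apply/eqP; rewrite -eqe -closed_borel_fin//.
  have cphir : closed [set x | r <= phi x].
    apply: (@preimage_closed _ _ phi [set y | r <= y]); last exact: closed_ge.
    by move=> x _; exact: cphi.
  rewrite eq_le measure_ge0 andbT -[leRHS](self_affine_confined affmu cphi phiP).
  apply: le_measure; rewrite ?inE; [exact: closed_borel|exact: closed_borel|].
  move=> x /= [Eb Eb']; rewrite leNgt; apply/negP => phix.
  have avoid e : e \in B -> (tau A e @` T) (tauw A (c :: v ++ w) x) -> c = e.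
    move=> eB [t Tt].
    have [u [uB usize [y Ty ->]]] := attractor_word (size (v ++ w)) attT Tt => ty.
    apply: (wP c e v u x y) => //; last exact: TG.
    by move=> z; rewrite in_cons => /predU1P[->|/uB].
  by move/eqP: bb'; apply; rewrite -(avoid _ bB Eb) -(avoid _ b'B Eb').
Qed.

Theorem theorem1p6 (K : realType) (d : nat) (A : 'M[int]_d)
    (B : {fset 'cV[int]_d}) :
  expansive K A -> simple_digit_set A B ->
  [/\ open_set_condition K A B,
      forall T : set 'cV[K]_d, is_attractor A B T ->
        strong_open_set_condition A B T
    & forall (T : set 'cV[K]_d) (mu : probability (borel_space K d) K),
        is_attractor A B T -> is_self_affine_measure A B mu ->
        no_overlap A B T mu].
Proof.
move=> expA simpleB.
have osc (T : set 'cV[K]_d) : compact T -> exists2 U, osc_set A B U &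
    is_attractor A B T -> U `&` T !=set0.
  move=> cT; have [phi [r [cphi phi0 phige phiP TG]]] := lyapunov_function B expA cT.
  have [||||U oscU UT] := @osc_set_exists K d A B expA simpleB [set x | phi x < r].
  - apply: (@open_comp _ _ phi [set y | y < r]) => [x _|].
      exact: cphi.
    exact: open_lt.
  - by exists 0.
  - by exists r => x /ltW phir i; apply: le_trans (phige x i) phir.
  - move=> b x bB /= phix; rewrite ltNge; apply/negP => /(phiP _ _ _ bB (lexx r)).
    by rewrite leNgt (lt_trans phix)// ltrDl.
  - exists U => // attT; apply: UT => //; have [[t Tt] _ _] := attT.
    by exists t; split=> //; exact: TG.
split.
(* No attractor is given here, so the empty set serves as the compact [T]. *)
- by have [U oscU _] := osc set0 compact0; exists U.
- by move=> T attT; have [_ cT _] := attT; have [U oscU /(_ attT)] := osc T cT; exists U.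
- by move=> T mu; exact: no_overlap_of_separating.
Qed.
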